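(* The generating function for partitions with respect to the side length of the smallest square containing their Young diagram and their degree of symmetry is $$\sum_{\lambda\in\mathcal P} s^{\mathrm{ds}(\lambda)} z^{\max\{\lambda_1,\lambda'_1\}} = \frac{1-sz}{2(1-s)z + \sqrt{1-4z}}.$$
   Context: $\mathcal P$ is the set of all integer partitions, i.e. sequences $\lambda=(\lambda_1,\dots,\lambda_k)$ with $k\ge0$ and $\lambda_1\ge\dots\ge\lambda_k\ge1$ (including the empty partition, for which $\lambda_1=\lambda_1'=0$). The conjugate $\lambda'$ of $\lambda$ is the partition with parts $\lambda'_i=|\{j:\lambda_j\ge i\}|$ for $1\le i\le\lambda_1$; in particular $\lambda_1'$ is the number of parts of $\lambda$. The degree of symmetry is $\mathrm{ds}(\lambda)=|\{i:\lambda_i=\lambda'_i\}|$, the number of parts of $\lambda$ that equal the corresponding part of its conjugate (only indices $i$ for which both $\lambda_i$ and $\lambda_i'$ are defined, i.e. are positive parts, count). The identity is between formal power series in $z$ with coefficients polynomials in $s$, with $\sqrt{1-4z}$ having constant term $1$. *)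

(* Defs.v *)
From HB Require Import structures.
From mathcomp Require Import all_boot all_order all_algebra.
From mathcomp Require Import boolp classical_sets functions cardinality fsbigop.

Set Implicit Arguments.
Unset Strict Implicit.
Unset Printing Implicit Defensive.

Import GRing.Theory.
Local Open Scope ring_scope.

Record fps (R : Type) := Fps { fps_coef :> nat -> R }.

HB.instance Definition _ (R : Type) := [isNew for @fps_coef R].
HB.instance Definition _ (R : choiceType) := [Choice of fps R by <:].

Lemma fpsP (R : Type) (f g : fps R) : f =1 g <-> f = g.
Proof.
split=> [fg|-> //]; case: f g fg => f [g] /= fg.
by congr Fps; apply/funext.
Qed.

Section FpsRing.
Variable R : comNzRingType.
Implicit Types (f g h : fps R) (n : nat).

Definition fps_zero : fps R := Fps (fun=> 0).
Definition fps_opp f : fps R := Fps (fun n => - f n).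
Definition fps_add f g : fps R := Fps (fun n => f n + g n).

Let addA : associative fps_add.
Proof. by move=> f g h; apply/fpsP => n; exact: addrA. Qed.
Let addC : commutative fps_add.
Proof. by move=> f g; apply/fpsP => n; exact: addrC. Qed.
Let add0 : left_id fps_zero fps_add.
Proof. by move=> f; apply/fpsP => n; exact: add0r. Qed.
Let addN : left_inverse fps_zero fps_opp fps_add.
Proof. by move=> f; apply/fpsP => n; exact: addNr. Qed.

HB.instance Definition _ := GRing.isZmodule.Build (fps R) addA addC add0 addN.

Definition fps_one : fps R := Fps (fun n => (n == 0%N)%:R).
Definition fps_mul f g : fps R :=
  Fps (fun n => \sum_(i < n.+1) f i * g (n - i)%N).

Let trunc N f : {poly R} := \poly_(i < N.+1) f i.

Let truncE N f n : (n <= N)%N -> (trunc N f)`_n = f n.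
Proof. by move=> nN; rewrite coef_poly ltnS nN. Qed.

Let mul_trunc N f g n : (n <= N)%N -> fps_mul f g n = (trunc N f * trunc N g)`_n.
Proof.
move=> nN; rewrite coefM /=; apply: eq_bigr => i _.
have iN : (i <= N)%N by rewrite (leq_trans _ nN) // -ltnS.
by rewrite !truncE // (leq_trans (leq_subr _ _)).
Qed.

Let mulC : commutative fps_mul.
Proof. by move=> f g; apply/fpsP => n; rewrite !(mul_trunc _ _ (leqnn n)) mulrC. Qed.

Let mulA : associative fps_mul.
Proof.
move=> f g h; apply/fpsP => n.
transitivity ((trunc n f * (trunc n g * trunc n h))`_n).
  rewrite [RHS]coefM; apply: eq_bigr => i _.
  by rewrite (@mul_trunc n) ?leq_subr// truncE // -ltnS.
rewrite mulrA [LHS]coefM; apply: eq_bigr => i _.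
by rewrite -(@mul_trunc n) ?truncE ?leq_subr// -ltnS.
Qed.

Let mul1 : left_id fps_one fps_mul.
Proof.
move=> f; apply/fpsP => n /=.
rewrite big_ord_recl /= subn0 mul1r big1 ?addr0// => i _.
by rewrite mul0r.
Qed.

Let mulDl : left_distributive fps_mul fps_add.
Proof.
move=> f g h; apply/fpsP => n /=.
by rewrite -big_split; apply: eq_bigr => i _; exact: mulrDl.
Qed.

Let one_neq0 : fps_one != 0.
Proof.
by apply/eqP => /(congr1 (fun f : fps R => f 0%N))/eqP; rewrite /= oner_eq0.
Qed.

HB.instance Definition _ :=
  GRing.Zmodule_isComNzRing.Build (fps R) mulA mulC mul1 mulDl one_neq0.

Definition fpsC (c : R) : fps R := Fps (fun n => c *+ (n == 0%N)).
Definition fpsX : fps R := Fps (fun n => (n == 1%N)%:R).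

Lemma fps_coef0 n : (0 : fps R) n = 0. Proof. by []. Qed.
Lemma fps_coef1 n : (1 : fps R) n = (n == 0%N)%:R. Proof. by []. Qed.
Lemma fps_coefD f g n : (f + g) n = f n + g n. Proof. by []. Qed.
Lemma fps_coefN f n : (- f) n = - f n. Proof. by []. Qed.
Lemma fps_coefB f g n : (f - g) n = f n - g n. Proof. by []. Qed.
Lemma fps_coefM f g n : (f * g) n = \sum_(i < n.+1) f i * g (n - i)%N.
Proof. by []. Qed.

Lemma fps_coefMn f k n : (f *+ k) n = f n *+ k.
Proof. by elim: k => [|k IH]; rewrite ?mulr0n // !mulrS fps_coefD IH. Qed.

Lemma fps_coefCM c f n : (fpsC c * f) n = c * f n.
Proof.
rewrite fps_coefM big_ord_recl /= subn0 mulr1n big1 ?addr0// => i _.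
by rewrite mulr0n mul0r.
Qed.

Lemma fpsC_exp c k : fpsC (c ^+ k) = fpsC c ^+ k.
Proof.
elim: k => [//|k IH]; apply/fpsP => n.
by rewrite [fpsC c ^+ _]exprS -IH fps_coefCM /= exprS mulrnAr.
Qed.

Lemma fps_coefXM f n : (fpsX * f) n = if n is m.+1 then f m else 0.
Proof.
rewrite fps_coefM big_ord_recl /= mul0r add0r.
case: n => [|n]; first by rewrite big_ord0.
rewrite big_ord_recl /= mul1r big1 ?addr0 ?subn1// => i _.
by rewrite mul0r.
Qed.

Lemma fps_coefXn m n : (fpsX ^+ m) n = (n == m)%:R.
Proof.
by elim: m n => [|m IH] [|n]; rewrite ?expr0 ?exprS ?fps_coefXM //.
Qed.

(* Series whose n-th coefficient is [F n c], where c lists the coefficients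
   of index < n (and is 0 beyond). *)
Fixpoint fps_prefix (F : nat -> (nat -> R) -> R) n : seq R :=
  if n is m.+1 then
    let s := fps_prefix F m in rcons s (F m (fun i => s`_i))
  else [::].

Definition fps_rec (F : nat -> (nat -> R) -> R) : fps R :=
  Fps (fun n => (fps_prefix F n.+1)`_n).

Lemma size_fps_prefix F n : size (fps_prefix F n) = n.
Proof. by elim: n => //= n IH; rewrite size_rcons IH. Qed.

Lemma nth_fps_prefix F n i : (i < n)%N -> (fps_prefix F n)`_i = fps_rec F i.
Proof.
elim: n => // n IH; rewrite ltnS leq_eqVlt => /predU1P[-> //|lin] /=.
by rewrite nth_rcons size_fps_prefix lin IH.
Qed.

Lemma fps_recE (F : nat -> (nat -> R) -> R) n :
  (forall g h : nat -> R, (forall i, (i < n)%N -> g i = h i) -> F n g = F n h) ->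
  fps_rec F n = F n (fps_rec F).
Proof.
move=> Fext; rewrite /= nth_rcons size_fps_prefix ltnn eqxx.
by apply: Fext => i lin; rewrite nth_fps_prefix.
Qed.

End FpsRing.

Arguments fpsX {R}.

Section FpsUnit.
Variable R : comUnitRingType.
Implicit Types (f g r : fps R) (n : nat).

Definition fps_unit : pred (fps R) := fun f => f 0%N \is a GRing.unit.

Definition fps_inv f : fps R :=
  if fps_unit f then
    fps_rec (fun n c =>
      (f 0%N)^-1 * ((n == 0%N)%:R - \sum_(i < n) c i * f (n - i)%N))
  else f.

Let mulV : {in fps_unit, left_inverse 1 fps_inv *%R}.
Proof.
move=> f fU; rewrite /fps_inv (fU : fps_unit f).
set F := (F in fps_rec F); apply/fpsP => n.
rewrite fps_coefM big_ord_recr /= subnn -/(fps_rec F n).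
rewrite [X in _ + X * _]fps_recE; last first.
  by move=> g h gh; congr (_ * (_ - _)); apply: eq_bigr => i _; rewrite gh.
by rewrite mulrAC mulVr // mul1r addrC subrK.
Qed.

Let unitP f g : g * f = 1 -> fps_unit f.
Proof.
move=> /(congr1 (fun h : fps R => h 0%N)).
rewrite fps_coefM big_ord1 subnn /= => gf1.
by apply/unitrP; exists (g 0%N); rewrite [f _ * _]mulrC gf1.
Qed.

Let inv_out : {in [predC fps_unit], fps_inv =1 id}.
Proof. by move=> f /negbTE fN; rewrite /fps_inv (fN : fps_unit f = false). Qed.

HB.instance Definition _ :=
  GRing.ComNzRing_hasMulInverse.Build (fps R) mulV unitP inv_out.

Lemma fps_unitE f : (f \is a GRing.unit) = (f 0%N \is a GRing.unit).
Proof. by []. Qed.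

(* When 2 is a unit and f has constant term 1, this is the square root of f
   with constant term 1, see [fps_sqrtP] and [fps_sqrt_unique]. *)
Definition fps_sqrt f : fps R :=
  fps_rec (fun n c =>
    if n == 0%N then 1 else (f n - \sum_(1 <= i < n) c i * c (n - i)%N) / 2).

Lemma fps_coef_sqr r n : r 0%N = 1 ->
  (r ^+ 2) n.+1 = 2 * r n.+1 + \sum_(1 <= i < n.+1) r i * r (n.+1 - i)%N.
Proof.
move=> r0; rewrite expr2 fps_coefM -(big_mkord xpredT (fun i => r i * r (n.+1 - i)%N)).
rewrite big_nat_recr //= big_ltn // subn0 subnn r0 mul1r mulr1.
by rewrite mulr_natl mulr2n addrAC.
Qed.

Lemma fps_sqrt0 f : fps_sqrt f 0%N = 1. Proof. by []. Qed.

Lemma fps_sqrtP f : (2 : R) \is a GRing.unit -> f 0%N = 1 ->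
  fps_sqrt f ^+ 2 = f.
Proof.
move=> U2 f0; apply/fpsP => -[|n]; first by rewrite expr2 fps_coefM big_ord1 subnn !fps_sqrt0 mulr1 f0.
rewrite fps_coef_sqr // [X in 2 * X]fps_recE /=; last first.
  move=> g h gh; congr ((_ - _) / _); apply: eq_big_nat => i /andP[i0 lin].
  by rewrite !gh // ltn_subrL i0.
by rewrite mulrC divrK // subrK.
Qed.

Lemma fps_sqrt_unique f r : (2 : R) \is a GRing.unit ->
  r 0%N = 1 -> r ^+ 2 = f -> r = fps_sqrt f.
Proof.
move=> U2 r0 rf.
have f0 : f 0%N = 1 by rewrite -rf expr2 fps_coefM big_ord1 subnn r0 mulr1.
apply/fpsP => n; elim/ltn_ind: n => -[|n] IH; first by rewrite r0.
have /(congr1 (fun h : fps R => h n.+1)) := etrans rf (esym (fps_sqrtP U2 f0)).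
rewrite !fps_coef_sqr //.
rewrite [X in _ + X](_ : _ =
  \sum_(1 <= i < n.+1) fps_sqrt f i * fps_sqrt f (n.+1 - i)%N); last first.
  apply: eq_big_nat => i /andP[i0 lin]; rewrite !IH //.
  by rewrite ltn_subrL i0.
by move/addIr/(mulrI U2).
Qed.

End FpsUnit.

Lemma fps_sqrt_1B4X :
  (fps_sqrt (1 - 4 * fpsX) : fps {poly rat}) ^+ 2 = 1 - 4 * fpsX.
Proof.
apply: fps_sqrtP; last by rewrite fps_coefB mulrC fps_coefXM fps_coef1 subr0.
by rewrite -[2]polyC_natr poly_unitE coefC size_polyC.
Qed.

Lemma fps_denom_unit (f : fps {poly rat}) :
  f * fpsX + fps_sqrt (1 - 4 * fpsX) \is a GRing.unit.
Proof. by rewrite fps_unitE fps_coefD mulrC fps_coefXM add0r fps_sqrt0 unitr1. Qed.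

(* Coefficientwise sum of a family of series; [\sum_(i \in A)] is the library
   sum over a possibly infinite set, with junk value 0 when infinitely many
   terms are nonzero, so this is the usual sum for summable families only. *)
Definition fps_sum (R : comNzRingType) (I : choiceType) (A : set I)
    (F : I -> fps R) : fps R :=
  Fps (fun n => \sum_(i \in A) F i n).

Definition fps_summable (R : comNzRingType) (I : choiceType) (A : set I)
    (F : I -> fps R) : Prop :=
  forall n, finite_set [set i | A i /\ F i n != 0].

Definition is_part (la : seq nat) : bool := sorted geq la && (0%N \notin la).

(* Parts are indexed from 0 in the code: [nth 0 la i] is the part of index
   i + 1, and [head 0 la] is the largest part, 0 for the empty partition. *)
Definition conj_part (la : seq nat) : seq nat :=
  [seq count (fun p => i <= p)%N la | i <- iota 1 (head 0%N la)].

Definition ds (la : seq nat) : nat :=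
  count (fun i => nth 0%N la i == nth 0%N (conj_part la) i)
        (iota 0 (minn (size la) (size (conj_part la)))).

Lemma is_part_head la p : is_part la -> p \in la -> (p <= head 0%N la)%N.
Proof.
case: la => //= a la /andP[/= pla _]; rewrite inE => /predU1P[-> //|pin].
have geq_trans : transitive geq by move=> x y z /= xy yz; exact: leq_trans yz xy.
by move: pla; rewrite (path_sortedE geq_trans) => /andP[/allP/(_ _ pin)].
Qed.

Lemma head_conj_part la : is_part la -> head 0%N (conj_part la) = size la.
Proof.
case: la => [//|[|a] la] /andP[_ la0]; first by rewrite inE in la0.
rewrite /conj_part /=; apply/eqP; rewrite add1n eqSS -all_count; apply/allP => p pin.
by rewrite lt0n; apply: contra la0 => /eqP <-; rewrite inE pin orbT.
Qed.

Lemma ds_summable :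
  fps_summable [set la | is_part la] (fun la => fpsC ('X : {poly rat}) ^+ ds la *
    fpsX ^+ maxn (head 0%N la) (head 0%N (conj_part la))).
Proof.
move=> n.
pose T := {k : 'I_n.+1 & k.-tuple 'I_n.+1}.
pose h (t : T) : seq nat := [seq val x | x <- tagged t].
apply: (@sub_finite_set _ _ (h @` [set: T])%classic); last first.
  exact/finite_image/finite_finset.
move=> la [pla]; have {}pla : is_part la := pla.
rewrite -fpsC_exp fps_coefCM fps_coefXn.
have [nE _|] := eqVneq n (maxn (head 0%N la) (head 0%N (conj_part la))); last by rewrite mulr0 eqxx.
have hn : (head 0%N la <= n)%N by rewrite nE leq_maxl.
have sn : (size la < n.+1)%N by rewrite ltnS nE -(head_conj_part pla) leq_maxr.
have st : size [seq inord x : 'I_n.+1 | x <- la] == Ordinal sn by rewrite size_map.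
exists (Tagged (fun k : 'I_n.+1 => k.-tuple 'I_n.+1) (Tuple st)) => //.
rewrite /h /= -map_comp -[RHS]map_id; apply/eq_in_map => p pin /=.
by rewrite inordK // ltnS (leq_trans (is_part_head pla pin)).
Qed.

(* Main.v *)
(* Read the boundary of a diagram inside an n x n box from both ends towards
   the diagonal and reflect one half: this gives two n-step lattice paths with
   common endpoints, and the indices i with lambda_i = lambda'_i are the common
   steps of the two paths. Let A_h be the generating function of such pairs
   for diagrams inside boxes with m + h rows and m - h columns, with z marking m
   and s marking common steps. Looking at the first step of each path,
     A_0 = 1 + 2 z (s A_0 + A_1),  A_h = z (2 A_h + A_(h-1) + A_(h+1)),
   whose unique solution is A_h = F^h / (1 - 2sz - 2zF) with F = z (1 + F)^2,
   that is 2zF = 1 - 2z - sqrt(1 - 4z). Diagrams whose smallest square is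
   exactly n x n are those of the n x n box minus those of the (n-1) x (n-1)
   box; the latter start with an extra common step, so A_0 is multiplied by
   1 - sz. *)

Require Import Defs.
From HB Require Import structures.
From mathcomp Require Import all_boot all_order all_algebra.
From mathcomp Require Import boolp classical_sets functions cardinality fsbigop.
From mathcomp Require Import zify ring.

Set Implicit Arguments.
Unset Strict Implicit.
Unset Printing Implicit Defensive.

Import GRing.Theory.

(** * Boundary words, their rows and columns *)

(* A word is the boundary of a diagram in a box, read from the north-east to the
   south-west corner, [true] being a vertical step; there is one row for each
   [true], so [rows w] and [cols w] are a partition and its conjugate padded
   with zeros. *)
Fixpoint rows (w : seq bool) : seq nat :=
  if w is x :: w' then
    if x then count negb w' :: rows w' else rows w'
  else [::].

(** Reading the boundary backwards with the two kinds of steps exchanged reflects the diagram in its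
    diagonal. *)
Definition dual (w : seq bool) : seq bool := map negb (rev w).

Definition cols (w : seq bool) : seq nat := rows (dual w).

Lemma dualK : involutive dual.
Proof.
move=> w; rewrite /dual -map_rev revK -map_comp -[RHS]map_id.
by apply: eq_map => x /=; rewrite negbK.
Qed.

Lemma size_dual w : size (dual w) = size w.
Proof. by rewrite size_map size_rev. Qed.

Lemma count_dual w : count id (dual w) = count negb w.
Proof. by rewrite count_map count_rev. Qed.

Lemma countN_dual w : count negb (dual w) = count id w.
Proof. by rewrite -count_dual dualK. Qed.

Lemma cols_dual w : cols (dual w) = rows w.
Proof. by rewrite /cols dualK. Qed.

Lemma dual_cons x w : dual (x :: w) = rcons (dual w) (~~ x).
Proof. by rewrite /dual rev_cons map_rcons. Qed.

Lemma dual_rcons w x : dual (rcons w x) = ~~ x :: dual w.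
Proof. by rewrite /dual rev_rcons. Qed.

Lemma count_rcons (T : Type) (a : pred T) s x :
  count a (rcons s x) = (count a s + a x)%N.
Proof. by rewrite -cats1 count_cat /= addn0. Qed.

Lemma size_rows w : size (rows w) = count id w.
Proof. by elim: w => [|[] w IHw] //=; rewrite IHw. Qed.

Lemma size_cols w : size (cols w) = count negb w.
Proof. by rewrite size_rows count_dual. Qed.

Lemma rows_rcons w x :
  rows (rcons w x) = if x then rcons (rows w) 0%N else map S (rows w).
Proof.
elim: w => [|y w IHw]; first by case: x.
by case: y; case: x IHw => /= -> //; rewrite count_rcons ?addn0 ?addn1.
Qed.

Lemma cols_cons x w :
  cols (x :: w) = if x then map S (cols w) else rcons (cols w) 0%N.
Proof. by rewrite /cols dual_cons rows_rcons if_neg. Qed.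

Lemma cols_rcons w x :
  cols (rcons w x) = if x then cols w else count id w :: cols w.
Proof. by rewrite /cols dual_rcons /= countN_dual if_neg. Qed.

Lemma rows_le w p : p \in rows w -> (p <= count negb w)%N.
Proof.
elim: w => [|[] w IHw] //=; first by rewrite inE add0n => /predU1P[->|/IHw].
by move/IHw/leq_trans; apply; rewrite leq_addl.
Qed.

Lemma nth_rows_le w i : (nth 0%N (rows w) i <= count negb w)%N.
Proof.
have [ile|isz] := leqP (size (rows w)) i; first by rewrite nth_default.
exact/rows_le/mem_nth.
Qed.

Definition geq_trans : transitive geq := fun _ _ _ xy yz => leq_trans yz xy.

Lemma rows_sorted w : sorted geq (rows w).
Proof.
elim: w => [|[] w IHw] //=.
rewrite (path_sortedE geq_trans).
by rewrite IHw andbT; apply/allP => p /rows_le.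
Qed.

Lemma nth_cols w i : nth 0%N (cols w) i = count (fun p => (i < p)%N) (rows w).
Proof.
elim: w => [|x w IHw]; first by rewrite nth_nil.
rewrite cols_cons; case: x => /=; last by rewrite nth_rcons_default.
rewrite -IHw; have [iw|iw] := ltnP i (size (cols w)).
  by rewrite (nth_map 0%N) // -size_cols iw.
by rewrite !nth_default ?size_map // -size_cols ltnNge iw.
Qed.

(** * Common steps when the two outer letters are removed *)

(* Common steps of the two half boundaries of a diagram in an
   (m + h) x (m - h) box: once the starting points are made to agree, row j + h
   has the index of column j, and its length is shifted by h. *)
Definition common h w : nat :=
  \sum_(j < count negb w) (nth 0%N (rows w) (j + h) + h == nth 0%N (cols w) j)%N.

Lemma nth_mapS s i : (i < size s)%N -> nth 0%N (map S s) i = (nth 0%N s i).+1.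
Proof. exact: nth_map. Qed.

(** The new first row and column are full: for h = 0 they agree, for h > 0 row h is too short to
    match column 0. Every other comparison gains one on both sides. *)
Lemma common_TF h w : count id w = (count negb w + h.*2)%N ->
  common h (true :: rcons w false) = ((h == 0%N) + common h w)%N.
Proof.
move=> cw; rewrite /common [rows _]/= cols_cons cols_rcons rows_rcons /=.
rewrite !count_rcons /= addn1 add0n big_ord_recl /= add0n; congr (_ + _)%N.
  case: h cw => [|h] cw; first by rewrite cw /= !addn0 eqxx.
  congr nat_of_bool; apply/negbTE.
  rewrite addnS /=; have [hs|hs] := ltnP h (size (rows w)).
    by rewrite nth_mapS //; have := nth_rows_le w h; lia.
  by rewrite nth_default ?size_map //; lia.
apply: eq_bigr => j _; rewrite !add0n.
have jw := ltn_ord j.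
by rewrite !nth_mapS ?size_cols ?size_rows ?cw ?addSn ?eqSS //; lia.
Qed.

(** The new last column is empty; it finds a match only for h = 0, where its partner is the new
    empty row. *)
Lemma common_FT h w : count id w = (count negb w + h.*2)%N ->
  common h (false :: rcons w true) = (common h w + (h == 0%N))%N.
Proof.
move=> cw; rewrite /common [rows _]/= cols_cons cols_rcons rows_rcons /=.
rewrite !count_rcons /= addn0 add1n big_ord_recr /=; congr (_ + _)%N.
  by apply: eq_bigr => j _; rewrite !nth_rcons_default.
rewrite !nth_rcons_default [X in _ == X]nth_default ?size_cols //.
case: h cw => [|h] cw; last by rewrite addnS.
by rewrite nth_default ?size_rows ?cw ?addn0.
Qed.

Lemma common_TT h w : count id w = (count negb w + h.*2)%N ->
  common h.+1 (true :: rcons w true) = common h w.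
Proof.
move=> cw; rewrite /common [rows _]/= cols_cons cols_rcons rows_rcons /=.
rewrite !count_rcons /= addn0 add0n; apply: eq_bigr => j _.
have jw := ltn_ord j.
by rewrite !addnS /= nth_rcons_default nth_mapS ?size_cols //.
Qed.

(** Of the two new columns, the full one is too long and the empty one too short for a match.
    Dropping the former raises the shift to h + 1. *)
Lemma common_FF h w : count id w = (count negb w + h.+1.*2)%N ->
  common h (false :: rcons w false) = common h.+1 w.
Proof.
move=> cw; rewrite /common [rows _]/= cols_cons cols_rcons rows_rcons /=.
rewrite !count_rcons /= addn1 add1n big_ord_recl big_ord_recr /= add0n.
rewrite -[RHS]add0n -[in RHS](addn0 (bigop _ _ _)); congr (_ + (_ + _))%N.
- rewrite nth_mapS ?size_rows ?cw; last by lia.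
  by case: eqP => //; have := nth_rows_le w h; lia.
- apply: eq_bigr => j _; have jw := ltn_ord j.
  rewrite !add0n nth_rcons_default nth_mapS ?size_rows /bump leq0n; last by lia.
  by rewrite !addnS !addSn.
rewrite add0n nth_rcons_default [X in _ == X]nth_default ?size_cols //.
by rewrite nth_mapS ?size_rows /bump; lia.
Qed.

Lemma common0_dual w : count id w = count negb w ->
  common 0 (dual w) = common 0 w.
Proof.
move=> cw; rewrite /common countN_dual cw; apply: eq_bigr => j _.
by rewrite cols_dual !addn0 eq_sym.
Qed.

(** * Words of even length, built from the middle outwards *)

Definition extend (xy : bool * bool) (w : seq bool) : seq bool :=
  xy.1 :: rcons w xy.2.

Definition letter_pairs : seq (bool * bool) :=
  [:: (true, false); (false, true); (true, true); (false, false)].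

Fixpoint words m : seq (seq bool) :=
  if m is m'.+1 then
    [seq extend xy w | xy <- letter_pairs, w <- words m']
  else [:: [::]].

Lemma mem_words m w : (w \in words m) = (size w == m.*2).
Proof.
elim: m w => [|m IHm] w; first by rewrite inE size_eq0.
apply/allpairsP/eqP => [[[xy v] [_ vm ->]]|].
  by move: vm; rewrite IHm /extend /= size_rcons doubleS => /eqP->.
case: w => [//|x w]; case: (lastP w) => [//|{}w y].
rewrite /= size_rcons doubleS => -[sw].
exists ((x, y), w); split=> //; first by case: x y => -[].
by rewrite IHm sw.
Qed.

Lemma words_uniq m : uniq (words m).
Proof.
elim: m => [//|m IHm]; apply: allpairs_uniq => // -[[x y] v] [[x' y'] v'] _ _.
by rewrite /extend /= => -[-> /rcons_inj[-> ->]].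
Qed.

Lemma perm_dual_words m : perm_eq (map dual (words m)) (words m).
Proof.
apply: uniq_perm; rewrite ?words_uniq ?(map_inj_uniq (can_inj dualK)) ?words_uniq //.
move=> w; rewrite -[w in LHS]dualK mem_map ?mem_words ?size_dual //.
exact: can_inj dualK.
Qed.

Lemma count_words m w : w \in words m -> (count id w + count negb w = m.*2)%N.
Proof. by rewrite mem_words -(count_predC id) => /eqP. Qed.

(** * Partitions in a square box as words *)

Fixpoint word q (la : seq nat) : seq bool :=
  if la is a :: la' then nseq (q - a) false ++ true :: word a la'
  else nseq q false.

Lemma wordS q la : (head 0 la <= q)%N -> word q.+1 la = false :: word q la.
Proof. by case: la => //= a la aq; rewrite subSn. Qed.

(** The number of columns must be supplied, since the rows alone do not determine the initial
    horizontal steps. *)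
Lemma word_rows w : word (count negb w) (rows w) = w.
Proof.
elim: w => [|[] w IHw] //=; first by rewrite add0n subnn IHw.
by rewrite add1n wordS ?IHw // -nth0 nth_rows_le.
Qed.

Lemma count_word q la : count id (word q la) = size la.
Proof.
elim: la q => [|a la IHla] q /=; first by rewrite count_nseq.
by rewrite count_cat count_nseq /= IHla.
Qed.

Lemma rows_nseq_false k w : rows (nseq k false ++ w) = rows w.
Proof. by elim: k. Qed.

Lemma countN_word q la : path geq q la -> count negb (word q la) = q.
Proof.
elim: la q => [|a la IHla] q /=; first by rewrite count_nseq mul1n.
by case/andP=> aq /IHla; rewrite count_cat count_nseq /= mul1n add0n => ->; rewrite subnK.
Qed.

Lemma rows_word q la : path geq q la -> rows (word q la) = la.
Proof.
elim: la q => [|a la IHla] q /=; first by rewrite -[nseq _ _]cats0 rows_nseq_false.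
by case/andP=> aq pa; rewrite rows_nseq_false /= countN_word // IHla.
Qed.

Definition strip (la : seq nat) := [seq p <- la | 0 < p].

Definition pad n (la : seq nat) := la ++ nseq (n - size la) 0.

Definition in_box n la := [&& is_part la, head 0 la <= n & size la <= n].

Lemma path_pad n la : in_box n la -> path geq n (pad n la).
Proof.
case/and3P=> pla hla _; rewrite /pad cat_path; apply/andP; split.
  by case/andP: pla => sla _; case: la hla sla => //= a la -> ->.
by elim: (n - size la) (last n la) => //= k IHk x; rewrite IHk.
Qed.

Lemma size_pad n la : in_box n la -> size (pad n la) = n.
Proof. by case/and3P=> _ _ sla; rewrite size_cat size_nseq subnKC. Qed.

Lemma strip_pad n la : is_part la -> strip (pad n la) = la.
Proof.
case/andP=> _ la0; rewrite /strip filter_cat -[RHS]cats0; congr (_ ++ _).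
  apply/all_filterP/allP => p pla; rewrite lt0n.
  by apply: contraNneq la0 => <-.
by apply/eqP; rewrite -(negbK (_ == _)) -has_filter has_nseq andbF.
Qed.

Definition parts n : seq (seq nat) :=
  [seq strip (rows w) | w <- words n & count id w == n].

Lemma is_part_strip w : is_part (strip (rows w)).
Proof.
rewrite /is_part mem_filter ltnn andbT /=.
exact/sorted_filter/rows_sorted/geq_trans.
Qed.

Lemma mem_parts n la : (la \in parts n) = in_box n la.
Proof.
apply/mapP/idP => [[w]|bla]; last first.
  have pla := path_pad bla.
  exists (word n (pad n la)); last by rewrite rows_word // strip_pad; case/and3P: bla.
  rewrite mem_filter mem_words -(count_predC id) countN_word // count_word.
  by rewrite size_pad // eqxx addnn eqxx.
rewrite mem_filter => /andP[/eqP wn /count_words]; rewrite wn -addnn => /addnI cw ->.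
rewrite /in_box is_part_strip /=; apply/andP; split.
  rewrite -[X in _ <= X]cw -nth0.
  have [sz|sz] := leqP (size (strip (rows w))) 0; first by rewrite nth_default.
  by apply: rows_le; move: (mem_nth 0 sz); rewrite mem_filter => /andP[].
by rewrite -[X in _ <= X]wn -size_rows size_filter count_size.
Qed.

Lemma pad_strip la : sorted geq la -> pad (size la) (strip la) = la.
Proof.
rewrite /pad; elim: la => [//|a la IHla] sla /=.
case: ltnP => [a0|] /=; first by rewrite subSS IHla // (path_sorted sla).
(* In a decreasing list only zeros follow a zero. *)
rewrite leqn0 => /eqP a0; move: sla; rewrite a0 /= (path_sortedE geq_trans).
case/andP => /allP la0 _.
have /all_pred1P -> : all (pred1 0) la.
  by apply/allP => p /la0 /=; rewrite leqn0.
have -> k : strip (nseq k 0) = [::] by elim: k.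
by rewrite size_nseq subn0.
Qed.

(** The box fixes the numbers of rows and columns, so padding the partition restores all rows, and
    these determine the word. *)
Lemma parts_uniq n : uniq (parts n).
Proof.
rewrite map_inj_in_uniq ?filter_uniq ?words_uniq // => w v.
rewrite !mem_filter => /andP[/eqP wn /count_words cw] /andP[/eqP vn /count_words cv] wv.
rewrite -(word_rows w) -(word_rows v).
rewrite -(pad_strip (rows_sorted w)) -(pad_strip (rows_sorted v)).
by rewrite wv !size_rows; congr (word _ (pad _ _)); lia.
Qed.

(** * Common steps as agreements with the conjugate *)

Lemma nth_conj_part la i : is_part la ->
  nth 0 (conj_part la) i = count (fun p => i < p) la.
Proof.
move=> pla; have [ih|hi] := ltnP i (head 0 la).
  by rewrite (nth_map 0) ?size_iota // nth_iota.
rewrite nth_default ?size_map ?size_iota //; apply/esym/eqP.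
rewrite -[_ == 0]negbK -lt0n -has_count; apply/hasPn => p /(is_part_head pla) ph.
by rewrite -leqNgt (leq_trans ph).
Qed.

Lemma nth_part_gt0 la i : is_part la -> (0 < nth 0 la i) = (i < size la).
Proof.
case/andP=> _ la0; case: (ltnP i (size la)) => [sz|sz]; last by rewrite nth_default.
by rewrite lt0n; apply: contraNneq la0 => <-; exact: mem_nth.
Qed.

Lemma nth_conj_part_gt0 la i : is_part la ->
  (0 < nth 0 (conj_part la) i) = (i < head 0 la).
Proof.
move=> pla; rewrite nth_conj_part // -has_count.
apply/hasP/idP => [[p /(is_part_head pla) ph /leq_trans]|ih]; first exact.
by exists (head 0 la) => //; case: la ih {pla} => //= a la _; exact: mem_head.
Qed.

(** Through the default 0, indices beyond both lists count as agreements, unlike in [ds]. *)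
Definition fixed n la := \sum_(i < n) (nth 0 la i == nth 0 (conj_part la) i).

Lemma common_fixed n w : count id w = n -> count negb w = n ->
  common 0 w = fixed n (strip (rows w)).
Proof.
move=> wn cw; rewrite /common cw; apply: eq_bigr => i _.
rewrite !addn0 nth_cols nth_conj_part ?is_part_strip //.
(* Padding zeros equal the default of [nth], and zero parts never satisfy i < p, so stripping
   changes neither side. *)
rewrite -{1}(pad_strip (rows_sorted w)) nth_cat nth_nseq if_same count_filter.
congr nat_of_bool; congr (_ == _).
  by case: ltnP => // sz; rewrite nth_default.
by apply: eq_count => p /=; case: p => //= p; rewrite andbT.
Qed.

Definition side la := maxn (head 0 la) (head 0 (conj_part la)).

Lemma in_box_side n la : in_box n la = is_part la && (side la <= n).
Proof.
rewrite /in_box /side; case pla: (is_part la) => //=.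
by rewrite head_conj_part // geq_max.
Qed.

(* In the smallest square no index has both parts zero, so counting up to its
   side adds nothing to [ds]. *)
Lemma fixed_side la : is_part la -> fixed (side la) la = ds la.
Proof.
move=> pla; rewrite /ds /fixed /side head_conj_part // size_map size_iota.
rewrite -sum1_count /= -[minn _ _]subn0 big_mkord.
set m := minn _ _; have mM : m <= maxn (head 0 la) (size la) by rewrite /m; lia.
rewrite (big_ord_widen_cond _ (fun i => nth 0 la i == nth 0 (conj_part la) i) (fun=> 1) mM).
rewrite [RHS]big_mkcond; apply: eq_bigr => i _.
have iM := ltn_ord i.
case: eqP => //= eqi; case: ltnP => // im; exfalso.
have := nth_part_gt0 i pla; rewrite eqi nth_conj_part_gt0 //; lia.
Qed.

(** At index n both parts are missing; this extra agreement is the source of the factor 1 - sz. *)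
Lemma fixedS n la : in_box n la -> fixed n.+1 la = (fixed n la).+1.
Proof.
case/and3P=> pla hla sla; rewrite /fixed big_ord_recr /= nth_default //.
by rewrite nth_default ?eqxx ?addn1 // size_map size_iota.
Qed.

Local Open Scope ring_scope.

(** * Recurrences from the first step of each path *)

Section Weight.
Variables (R : comNzRingType) (s : R).

(** The coefficient of z^m in A_h. *)
Definition weight h m : R :=
  \sum_(w <- words m | count id w == (m + h)%N) s ^+ common h w.

Lemma weight0 h : weight h 0 = (h == 0%N)%:R.
Proof.
rewrite /weight big_mkcond big_seq1 /= add0n eq_sym; case: eqP => // _.
by rewrite /common big_ord0.
Qed.

Lemma weight_extend h m :
  weight h m.+1 =
  \sum_(xy <- letter_pairs)
    \sum_(w <- words m | (xy.1 + count id w + xy.2)%N == (m.+1 + h)%N)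
       s ^+ common h (extend xy w).
Proof.
rewrite /weight big_mkcond big_allpairs_dep; apply: eq_bigr => -[x y] _.
by rewrite -big_mkcond; apply: eq_bigl => w; rewrite /= count_rcons addnA.
Qed.

Lemma sum_TF h m : \sum_(w <- words m | (1 + count id w + 0)%N == (m.+1 + h)%N)
    s ^+ common h (true :: rcons w false) = s ^+ (h == 0%N) * weight h m.
Proof.
rewrite big_distrr /= big_seq_cond [RHS]big_seq_cond.
apply: eq_big => w; first by congr andb; apply/eqP/eqP; lia.
by case/andP => /count_words cw /eqP wm; rewrite common_TF ?exprD //; lia.
Qed.

Lemma sum_FT h m : \sum_(w <- words m | (0 + count id w + 1)%N == (m.+1 + h)%N)
    s ^+ common h (false :: rcons w true) = s ^+ (h == 0%N) * weight h m.
Proof.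
rewrite big_distrr /= big_seq_cond [RHS]big_seq_cond.
apply: eq_big => w; first by congr andb; apply/eqP/eqP; lia.
by case/andP => /count_words cw /eqP wm; rewrite common_FT ?exprD 1?mulrC //; lia.
Qed.

Lemma sum_TT h m : \sum_(w <- words m | (1 + count id w + 1)%N == (m.+1 + h.+1)%N)
    s ^+ common h.+1 (true :: rcons w true) = weight h m.
Proof.
rewrite big_seq_cond [RHS]big_seq_cond.
apply: eq_big => w; first by congr andb; apply/eqP/eqP; lia.
by case/andP => /count_words cw /eqP wm; rewrite common_TT //; lia.
Qed.

Lemma sum_FF h m : \sum_(w <- words m | (0 + count id w + 0)%N == (m.+1 + h)%N)
    s ^+ common h (false :: rcons w false) = weight h.+1 m.
Proof.
rewrite big_seq_cond [RHS]big_seq_cond.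
apply: eq_big => w; first by congr andb; apply/eqP/eqP; lia.
by case/andP => /count_words cw /eqP wm; rewrite common_FF //; lia.
Qed.

(* Here the box becomes (m - 1) x (m + 1); conjugation exchanges this case with
   that of [sum_FF]. *)
Lemma sum_TT0 m : \sum_(w <- words m | (1 + count id w + 1)%N == (m.+1 + 0)%N)
    s ^+ common 0 (true :: rcons w true) = weight 1 m.
Proof.
rewrite -(perm_big _ (perm_dual_words m)) big_map -sum_FF.
rewrite big_seq_cond [RHS]big_seq_cond.
apply: eq_big => w.
  case wW: (w \in _) => //=; have cw := count_words wW.
  by rewrite count_dual; apply/eqP/eqP; lia.
case/andP => /count_words cw; rewrite count_dual => /eqP wm.
rewrite -[in RHS]common0_dual; last by rewrite /= !count_rcons /=; lia.
by rewrite dual_cons dual_rcons.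
Qed.

Lemma weight0S m : weight 0 m.+1 = (s * weight 0 m + weight 1 m) *+ 2.
Proof.
rewrite weight_extend /letter_pairs !big_cons big_nil /= addr0 sum_TF sum_FT sum_TT0 sum_FF.
by rewrite expr1; ring.
Qed.

Lemma weightSS h m :
  weight h.+1 m.+1 = weight h.+1 m *+ 2 + weight h m + weight h.+2 m.
Proof.
rewrite weight_extend /letter_pairs !big_cons big_nil /= addr0 sum_TF sum_FT sum_TT sum_FF.
by rewrite expr0 !mul1r mulr2n !addrA.
Qed.

End Weight.

(** * Partitions by the side of their smallest square *)

Lemma weight0_parts (R : comNzRingType) (s : R) n :
  weight s 0 n = \sum_(la <- parts n) s ^+ fixed n la.
Proof.
rewrite /weight big_map big_filter big_seq_cond [RHS]big_seq_cond.
apply: eq_big => w; first by rewrite addn0.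
case/andP=> /count_words cw /eqP; rewrite addn0 => wn.
by rewrite (@common_fixed n) //; lia.
Qed.

Lemma sum_side0 (R : comNzRingType) (s : R) :
  \sum_(la <- parts 0 | side la == 0%N) s ^+ ds la = weight s 0 0.
Proof.
rewrite weight0_parts big_seq_cond [RHS]big_seq_cond; apply: eq_big => la.
  case lan: (la \in _) => //=; move: lan.
  by rewrite mem_parts in_box_side leqn0 => /andP[_ ->].
by rewrite mem_parts in_box_side => /andP[/andP[pla _] /eqP <-]; rewrite fixed_side.
Qed.

Lemma sum_sideS (R : comNzRingType) (s : R) n :
  \sum_(la <- parts n.+1 | side la == n.+1) s ^+ ds la =
  weight s 0 n.+1 - s * weight s 0 n.
Proof.
apply/esym/(canLR (addrK _)); rewrite !weight0_parts.
rewrite (bigID (fun la => side la == n.+1)) /=; congr (_ + _).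
  rewrite big_seq_cond [RHS]big_seq_cond; apply: eq_bigr => la.
  by rewrite mem_parts in_box_side => /andP[/andP[pla _] /eqP <-]; rewrite fixed_side.
(* The diagrams of smaller side are those of the n x n box, each with one more factor s in the
   larger box. *)
rewrite -big_filter (perm_big (parts n)) /=; last first.
  apply: uniq_perm; rewrite ?filter_uniq ?parts_uniq // => la.
  rewrite mem_filter !mem_parts !in_box_side leq_eqVlt ltnS andbCA.
  by congr andb; case: eqP => //= ->; rewrite ltnn.
rewrite big_distrr /= big_seq [RHS]big_seq; apply: eq_bigr => la.
by rewrite mem_parts => /fixedS ->; rewrite exprS.
Qed.

(** * Solving the functional equations *)

Lemma fps_coefXS (R : comNzRingType) (f : fps R) n : (fpsX * f) n.+1 = f n.
Proof. exact: fps_coefXM. Qed.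

Lemma fpsX_inj (R : comNzRingType) : injective ( *%R (fpsX : fps R)).
Proof. by move=> f g fg; apply/fpsP => n; rewrite -!(fps_coefXS _ n) fg. Qed.

(** The factor z makes the coefficients of degree m + 1, for all h at once, depend only on those of
    degree m. *)
Lemma weight_gf (R : comNzRingType) (s : R) (f : nat -> fps R) :
  f 0%N = 1 + fpsX * ((fpsC s * f 0%N + f 1%N) *+ 2) ->
  (forall h, f h.+1 = fpsX * (f h.+1 *+ 2 + f h + f h.+2)) ->
  forall m h, f h m = weight s h m.
Proof.
move=> f0 fS; elim=> [|m IHm] [|h].
- by rewrite f0 fps_coefD fps_coefXM addr0 weight0.
- by rewrite fS fps_coefXM weight0.
- rewrite f0 fps_coefD fps_coefXS add0r mulr2n !fps_coefD fps_coefCM.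
  by rewrite !IHm weight0S mulr2n.
- by rewrite fS fps_coefXS mulr2n !fps_coefD !IHm weightSS mulr2n.
Qed.

Local Notation z := (fpsX : fps {poly rat}).
Local Notation root := (fps_sqrt (1 - 4 * z)).

Lemma unit2 : (2 : {poly rat}) \is a GRing.unit.
Proof. by rewrite -polyC_natr poly_unitE coefC size_polyC. Qed.

Lemma fps_unit2 : (2 : fps {poly rat}) \is a GRing.unit.
Proof. exact: unit2. Qed.

(** Here 1 + F is the Catalan series C, with C = 1 + z C^2. *)
Lemma first_passage_gf :
  exists2 F : fps {poly rat}, F = z * (1 + F) ^+ 2 & 2 * z * F = 1 - 2 * z - root.
Proof.
(* The series 1 - 2z - [root] has constant term 0, so dividing it by z is a shift. *)
pose F : fps {poly rat} := Fps (fun n => (1 - 2 * z - root) n.+1) / 2.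
have zF : 2 * z * F = 1 - 2 * z - root.
  rewrite -mulrA mulrC -mulrA divrK ?fps_unit2 //; apply/fpsP => -[|n].
    by rewrite fps_coefXM !fps_coefB fps_sqrt0 [2 * z]mulrC fps_coefXM subr0 fps_coef1 subrr.
  exact: fps_coefXS.
(* Multiplied by 4z, the equation says that 1 - 2z - 2zF squares to 1 - 4z. *)
exists F => //; apply: fpsX_inj; apply: (mulrI fps_unit2); apply: (mulrI fps_unit2).
have := fps_sqrt_1B4X; have -> : root = 1 - 2 * z - 2 * z * F by rewrite zF; ring.
move=> e; apply/subr0_eq; move/eqP: e; rewrite -subr_eq0 => /eqP e.
by rewrite -[RHS]oppr0 -e; ring.
Qed.

Lemma weight0_gf n :
  (2 * (1 - fpsC 'X) * z + root)^-1 n = weight 'X 0 n.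
Proof.
have [F FE zF] := first_passage_gf; set D := _ + root.
have DU : D \is a GRing.unit by exact: fps_denom_unit.
have DE : D = 1 - 2 * fpsC 'X * z - 2 * z * F by rewrite zF /D; ring.
(* Powers of F solve the recurrence in h; the equation at h = 0 fixes the factor 1 / D. *)
pose f h := F ^+ h * D^-1.
have f0 : f 0%N = D^-1 by rewrite /f expr0 mul1r.
rewrite -f0; apply: weight_gf => [|h].
  rewrite /f expr0 mul1r expr1; apply: (mulIr DU); rewrite mulVr //.
  rewrite mulrDl mul1r -mulrA mulrnAl mulrDl -!mulrA mulVr // DE; ring.
rewrite /f !exprS; set c := F ^+ h * _.
rewrite -[F * (F * _) * _]mulrA -![F * _ * D^-1]mulrA -/c.
(* Up to the common factor [c], this is F = z (1 + F)^2. *)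
by rewrite {1}FE; ring.
Qed.

Theorem corollary4p4 :
  let s : fps {poly rat} := fpsC 'X in
  let z : fps {poly rat} := fpsX in
  fps_sum [set la : seq nat | is_part la]%classic
    (fun la => s ^+ ds la * z ^+ maxn (head 0%N la) (head 0%N (conj_part la)))
  = (1 - s * z) / (2 * (1 - s) * z + fps_sqrt (1 - 4 * z)).
Proof.
move=> s z; apply/fpsP => n.
transitivity (\sum_(la <- parts n | side la == n) 'X ^+ ds la : {poly rat}).
  have coefE la : (s ^+ ds la * z ^+ side la) n =
      (if side la == n then 'X ^+ ds la else 0 : {poly rat}).
    by rewrite -fpsC_exp fps_coefCM fps_coefXn eq_sym; case: eqP; rewrite ?mulr1 ?mulr0.
  rewrite /= (@fsbigE _ _ _ _ _ (parts n)) ?parts_uniq //.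
  - rewrite [RHS]big_mkcond big_seq_cond [RHS]big_seq.
    apply: eq_big => la; last by move=> _; exact: coefE.
    rewrite mem_parts; case: (boolP (in_box n la)) => //= /and3P[pla _ _].
    exact: mem_set.
  - by move=> la /=; rewrite mem_parts => /and3P[].
  (* A partition outside the n x n box has side above n and contributes nothing in degree n, so the
     sum is finite. *)
  - move=> la /= pla; rewrite mem_parts in_box_side pla /= => nla.
    by rewrite [LHS]coefE; case: eqP nla => // ->; rewrite leqnn.
(* Multiplying by 1 - sz subtracts s times the preceding coefficient, as in [sum_sideS]. *)
have -> (y : fps {poly rat}) : (1 - s * z) * y = y - z * (s * y) by ring.
rewrite fps_coefB weight0_gf.
case: n => [|n]; first by rewrite fps_coefXM subr0 sum_side0.
by rewrite fps_coefXS fps_coefCM weight0_gf sum_sideS.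
Qed.
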